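(* Let $t_g$ be a gauged stable ribbon tree of arity $n\geqslant 2$ with orientation $\omega$, whose gauge intersects exactly $j$ vertices $v_1,\dots,v_j$, ordered from left to right. Consider a codimension one (gauge-vertex) boundary component of $\overline{\mathcal{CT}}_n(t_g)$, in which the gauge comes to cross exactly one additional vertex $v$ of $t$, located between the $k$-th and $(k+1)$-th intersections of $t_g$, and let $t_g^0$ be the resulting gauged tree (so its vertices on the gauge are $v_1,\dots,v_k,v,v_{k+1},\dots,v_j$). Suppose the crossing results from a move in which $v$ is above the gauge in $t_g$ (i.e. $-\lambda<d(r,v)$) and on the gauge in $t^0_g$. Then the boundary component $\mathcal{CT}_n(t^0_g,\omega)$ has sign $(-1)^{j+k+1}$ in the boundary of $\overline{\mathcal{CT}}_n(t_g,\omega)$.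
   Context: A ribbon tree is a planar rooted tree with one outgoing external edge, whose adjacent vertex is the root $r$, and $n$ incoming external edges ordered from left to right; it is stable if all vertices are at least trivalent. $E(t)$ is its set of internal edges, $e(t)=|E(t)|$. An orientation of $t$ is an ordering of $E(t)$ up to even permutation. A gauged stable ribbon tree $t_g$ is a stable ribbon tree $t$ with a partition of its vertices into vertices below the gauge (between gauge and outgoing edge), on the gauge (intersected by it), and above the gauge, such that the parent (next vertex towards $r$) of any vertex below or on the gauge is below the gauge. $\mathcal{CT}_n(t_g)$ is the polyhedral cone of $(\lambda,(l_e)_{e\in E(t)})\in\mathbb R\times\,]0,+\infty[^{e(t)}$ with $-\lambda>d(r,v)$ for $v$ below, $-\lambda=d(r,v)$ for $v$ on, $-\lambda<d(r,v)$ for $v$ above the gauge ($d(r,v)$ = sum of the lengths on the path from $r$ to $v$). It has dimension $e(t)+1-j$ if $j$ vertices are on the gauge. An orientation $\omega$ of $t$ orients it, giving $\mathcal{CT}_n(t_g,\omega)$: if $j=0$, as an open subset of $\mathbb R\times\,]0,+\infty[^{e(t)}$ (coordinate $\lambda$ first, then the lengths ordered by $\omega$); in general, with $v_1,\dots,v_j$ the vertices on the gauge from left to right and $\nu_k$ a vector outward-pointing for the half-space $-\lambda\geqslant d(r,v_k)$ (e.g. the gradient of $\lambda+d(r,v_k)$), it is cooriented by $(\nu_1,\dots,\nu_j)$, i.e. a basis of its tangent space is positive iff its concatenation after $(\nu_1,\dots,\nu_j)$ is positive. $\overline{\mathcal{CT}}_n(t_g)$ is the compactification of $\mathcal{CT}_n(t_g)$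 by limits of metric gauged trees (edges may collapse or break, the gauge may reach vertices). The (gauge-vertex) boundary consists of the codimension one strata $\mathcal{CT}_n(t_g^0)$ with the same underlying tree $t$ where exactly one inequality for a vertex $v$ has become an equality $-\lambda=d(r,v)$. A codimension one stratum with a given orientation has sign $\varepsilon$ in the boundary if the boundary orientation (outward-pointing vector first) is $\varepsilon$ times the given one. *)

(* Defs.v *)
From HB Require Import structures.
From mathcomp Require Import all_boot all_order all_algebra.
From mathcomp Require Import all_classical all_reals all_analysis.

Set Implicit Arguments.
Unset Strict Implicit.
Unset Printing Implicit Defensive.
Import Order.TTheory GRing.Theory Num.Theory.
Import numFieldNormedType.Exports.
Local Open Scope classical_set_scope.
Local Open Scope ring_scope.

(* A planar rooted tree, given by the list (from left to right) of what is    *)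
(* grafted on the incoming edges of its root.  [Input] is an incoming         *)
(* external edge, so that only [Vertex] nodes are vertices of the tree.       *)
Inductive rtree := Input | Vertex of seq rtree.

Fixpoint arity (t : rtree) : nat :=
  if t is Vertex ts then sumn (map arity ts) else 1%N.

(* The valence of a vertex is its number of incoming edges plus one.          *)
Fixpoint stable (t : rtree) : bool :=
  if t is Vertex ts then (2 < (size ts).+1)%N && all stable ts else true.

(* A vertex is represented by its address: the positions (counted from 0,     *)
(* from left to right) of the edges followed when climbing from the root.     *)
Fixpoint vertices (t : rtree) : seq (seq nat) :=
  if t is Vertex ts then
    [::] :: flatten (mkseq (fun i => map (cons i) (nth [::] (map vertices ts) i))
                           (size ts))
  else [::].

Definition vert (t : rtree) : finType := seq_sub (vertices t).

Definition addr (t : rtree) (v : vert t) : seq nat := ssval v.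

(* An internal edge is identified with its endpoint farther from the root, so *)
(* that E(t) is the set of the vertices other than the root.                  *)
Definition edge (t : rtree) : finType := {v : vert t | addr v != [::]}.

Definition on_path (t : rtree) (e : edge t) (v : vert t) : bool :=
  prefix (addr (val e)) (addr v).

Variant side := Below | On | Above.

Definition is_on (s : side) : bool := if s is On then true else false.

Definition partition3 (t : rtree) := vert t -> side.

(* [w] is the parent of [v] when addr v = rcons (addr w) i for some i.        *)
Definition is_gauge (t : rtree) (g : partition3 t) : Prop :=
  forall (w v : vert t) (i : nat),
    addr v = rcons (addr w) i -> g v <> Above -> g w = Below.

(* The vertices on a gauge are never ancestors of one another, and for such   *)
(* vertices the lexicographic order on addresses is the left-to-right order.  *)
Definition on_vertices (t : rtree) (g : partition3 t) : seq (vert t) :=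
  sort (fun v w => (addr v <= addr w :> seqlexi nat)%O)
       [seq v <- enum (vert t) | is_on (g v)].

Definition gauge_vertex_boundary (t : rtree) (g g0 : partition3 t) (v : vert t) :
  Prop := [/\ g v <> On, g0 v = On & forall w, w != v -> g0 w = g w].

Section Cones.
Variables (R : realType) (t : rtree).

(* An orientation of t is represented by an ordering [o] of E(t).  The space  *)
(* R x R^E(t) is read in coordinates: coordinate 0 is lambda and coordinate   *)
(* i + 1 is the length of the i-th edge of [o].  Frames are then oriented by  *)
(* the sign of a determinant, which only depends on the class of [o] up to    *)
(* even permutations.                                                         *)
Local Notation V := 'rV[R]_(#|edge t|.+1).

Variable o : #|edge t|.-tuple (edge t).
Implicit Types (g : partition3 t) (v : vert t).

Definition lambda (x : V) : R := x ord0 ord0.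

Definition len (x : V) (i : 'I_#|edge t|) : R :=
  x ord0 (lift ord0 i).

Definition dist (x : V) v : R :=
  \sum_(i < #|edge t| | on_path (tnth o i) v) len x i.

Definition CT g : set V :=
  [set x | (forall i, 0 < len x i) /\
           (forall v, match g v return Prop with
                      | Below => - lambda x > dist x v
                      | On => - lambda x = dist x v
                      | Above => - lambda x < dist x v
                      end)].

Definition gap v (x : V) : R^o := lambda x + dist x v.

Fact gap_is_linear v : linear (gap v).
Proof.
move=> a x y; rewrite /gap /dist /lambda /len !mxE scalerDr addrACA.
congr (_ + _); rewrite scaler_sumr -big_split /=.
by apply: eq_bigr => i _; rewrite !mxE.
Qed.

HB.instance Definition _ v :=
  GRing.isLinear.Build R V R^o *:%R (gap v)
    (gap_is_linear v).

(* The gradient of the linear form [gap v]; it points out of the half-space   *)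
(* - lambda >= d(r, v).                                                       *)
Definition normal v : V :=
  \row_j gap v (delta_mx ord0 j).

(* [CT g] is open in this linear subspace, which is its tangent space at each *)
(* of its points.                                                             *)
Definition tangent g : {vspace V} :=
  (\bigcap_(v | is_on (g v)) lker (linfun (gap v)))%VS.

(* The sign (1 if positive, -1 if negative) of a basis [b] of [tangent g] for *)
(* the coorientation of [CT g] by the normals of the vertices on the gauge.   *)
Definition orient g (b : seq V) : R :=
  Num.sg (\det (\matrix_(i < #|edge t|.+1)
                  (map normal (on_vertices g) ++ b)`_i)).

(* [u] points out of [CT g] at the boundary point [p].                        *)
Definition outward g (p u : V) : Prop :=
  u \in tangent g /\ \forall s \near 0^'+, CT g (p - s *: u).

(* [CT g0] is a codimension one stratum of the boundary of [CT g], and the    *)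
(* boundary orientation is [eps] times the orientation of [CT g0].  On the    *)
(* strata with underlying tree t (no edge collapsed or broken) the            *)
(* compactification of [CT g] is its closure in R x R^E(t).                   *)
Definition has_boundary_sign g g0 (eps : R) : Prop :=
  [/\ CT g0 `<=` closure (CT g) `\` CT g,
      \dim (tangent g) = (\dim (tangent g0)).+1 &
      forall p u b, CT g0 p -> outward g p u -> basis_of (tangent g0) b ->
        orient g (u :: b) = eps * orient g0 b].

End Cones.

Arguments has_boundary_sign R {t} o g g0 eps.

(* Main.v *)
(* Let x run over the entry following the normals of v_1, ..., v_j in the     *)
(* frames of the cone of g.  The determinant D(x) is a linear form <d, x>     *)
(* that vanishes on these normals and on the tangent space T0 of the          *)
(* boundary stratum, so d lies in the tangent space T of the cone and is      *)
(* orthogonal to T0.  Choosing w in T with gap_v(w) = 1, so that T is         *)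
(* spanned by w and T0, one gets D = gap_v * D(w) on T.  At d this reads      *)
(* |d|^2 = D(normal v) * D(w), so D(normal v) and D(w) have the same sign;    *)
(* at an outward u, for which gap_v(u) < 0, it gives D(u) the opposite sign.  *)
(* The remaining factor (-1)^(j - k) comes from moving the normal of v to     *)
(* its place after the k-th normal.                                           *)

From HB Require Import structures.
Require Import Defs.
From mathcomp Require Import all_boot all_order all_algebra perm.
From mathcomp Require Import all_classical all_reals all_analysis.
Import Order.TTheory GRing.Theory Num.Theory.
Import numFieldNormedType.Exports.
Local Open Scope classical_set_scope.
Local Open Scope ring_scope.

(** The geometry rests on [gap_dual]: each vertex on the gauge has a direction that changes its gap
    at unit rate and fixes the gaps of the other vertices on the gauge, since by [gauge_below] none
    of them is its descendant. Hence these gaps are independent linear forms, each vertex on the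
    gauge costs one dimension ([dim_tangent]), and the stratum has codimension one. The direction
    dual to [v] for [g0] also pushes any point of the stratum into [CT o g]: [v] passes above the
    gauge, equalities persist, and strict inequalities survive small moves ([near0_add_gt0]). For
    the sign, [orient_boundary] compares two determinants. The outward vector has negative gap at
    [v] while the normal of [v] has positive gap, which costs one sign; moving that normal across
    the [j - k] normals to its right costs the others. *)

(** * Determinants of lists of row vectors *)

Definition frame {R : comPzRingType} {n : nat} (b : seq 'rV[R]_n) : 'M[R]_n :=
  \matrix_(i < n) b`_i.

(** The size bound keeps both exchanged entries among the [n] rows that [frame] reads. *)
Lemma det_frame_swap (R : comPzRingType) (n : nat) (A C : seq 'rV[R]_n)
    (x y : 'rV[R]_n) : ((size A).+1 < n)%N ->
  \det (frame (A ++ x :: y :: C)) = - \det (frame (A ++ y :: x :: C)).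
Proof.
move=> ltAn; pose i0 := Ordinal (ltnW ltAn); pose i1 := Ordinal ltAn.
have i01 : i0 != i1 by rewrite -val_eqE /= neq_ltn ltnSn.
suff -> : frame (A ++ x :: y :: C) = xrow i0 i1 (frame (A ++ y :: x :: C)).
  by rewrite xrowE det_mulmx det_perm odd_tperm i01 expr1 mulN1r.
apply/row_matrixP => i.
have -> : row i (xrow i0 i1 (frame (A ++ y :: x :: C))) =
    row (tperm i0 i1 i) (frame (A ++ y :: x :: C)).
  by apply/rowP => k; rewrite !mxE.
rewrite !rowK; case: tpermP => [->|->|/eqP]; rewrite !nth_cat /=.
- by rewrite ltnn subnn ltnNge leqnSn subSnn.
- by rewrite ltnn subnn ltnNge leqnSn subSnn.
rewrite -!val_eqE /= => ii0 /eqP; rewrite -val_eqE /= => ii1.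
case: ltnP => // leAi; move: ii0 ii1; rewrite -(subnKC leAi) addKn.
case: (i - size A)%N => [|[|m]] //; first by rewrite addn0 eqxx.
by rewrite addn1 eqxx.
Qed.

Lemma det_frame_move (R : comPzRingType) (n : nat) (A B C : seq 'rV[R]_n)
    (x : 'rV[R]_n) : (size A + size B < n)%N ->
  \det (frame (A ++ B ++ x :: C)) =
  (-1) ^+ size B * \det (frame (A ++ x :: B ++ C)).
Proof.
elim: B A => [|y B IHB] A /=; first by rewrite expr0 mul1r.
move=> ltn; rewrite -cat_rcons IHB ?size_rcons ?addSnnS //.
rewrite cat_rcons det_frame_swap ?exprS ?mulrN ?mulN1r ?mulNr //.
by apply: leq_ltn_trans ltn; rewrite addnS ltnS leq_addr.
Qed.

Section Dot.
Context {R : comPzRingType} {n : nat}.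

Definition dot (x y : 'rV[R]_n) : R^o := \sum_j x ord0 j * y ord0 j.

Fact dot_is_linear x : linear (dot x).
Proof.
move=> a y z; rewrite /dot scaler_sumr -big_split; apply: eq_bigr => j _.
by rewrite !mxE /= mulrDr mulrCA.
Qed.

HB.instance Definition _ x :=
  GRing.isLinear.Build R 'rV[R]_n R^o *:%R (dot x) (dot_is_linear x).

Lemma dotC x y : dot x y = dot y x.
Proof. by apply: eq_bigr => j _; rewrite mulrC. Qed.

End Dot.

Lemma dot_gt0 {R : realDomainType} {n : nat} (x : 'rV[R]_n) :
  x != 0 -> 0 < dot x x.
Proof.
move=> x0; rewrite lt0r sumr_ge0 ?andbT; last first.
  by move=> j _; rewrite -expr2 sqr_ge0.
apply: contra x0; rewrite psumr_eq0 => [/allP xx0|j _]; last first.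
  by rewrite -expr2 sqr_ge0.
apply/eqP/rowP => j; have := xx0 j; rewrite mem_index_enum mxE mulf_eq0 orbb.
by move/(_ isT)/eqP.
Qed.

Lemma det_frame_linear (R : comPzRingType) (n : nat) (A C : seq 'rV[R]_n) :
  (size A < n)%N ->
  exists d : 'rV[R]_n, forall x,
    \det (frame (A ++ x :: C)) = dot d x.
Proof.
move=> ltAn; pose i0 := Ordinal ltAn.
(* Cofactors along row [i0] do not see that row, so [0] can stand there for [x]. *)
exists (\row_j cofactor (frame (A ++ 0 :: C)) i0 j) => x.
rewrite dotC (expand_det_row _ i0); apply: eq_bigr => j _.
rewrite !mxE nth_cat ltnn subnn /=; congr (_ * (_ * \det _)).
apply/matrixP => i k; rewrite !mxE !nth_cat /=.
by have := neq_lift i0 i; rewrite -val_eqE /=;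
  case: ltngtP => // ltAi _; rewrite -(subnSK ltAi).
Qed.

Lemma det_frame_alternate (R : comPzRingType) (n : nat) (A C : seq 'rV[R]_n)
    (x : 'rV[R]_n) : size (A ++ x :: C) = n -> x \in A ++ C ->
  \det (frame (A ++ x :: C)) = 0.
Proof.
move=> sz xAC.
have /(uniqPn 0) [i [j [ltij]]] : ~~ uniq (A ++ x :: C).
  rewrite cat_uniq /= negb_or mem_cat in xAC *.
  by case/orP: xAC => ->; rewrite ?andbF.
rewrite sz => ltjn eq_ij; pose i' := Ordinal (ltn_trans ltij ltjn).
apply: (@determinant_alternate _ _ _ i' (Ordinal ltjn)).
  by rewrite -val_eqE /= neq_ltn ltij.
by move=> k; rewrite !mxE /= eq_ij.
Qed.

(** * Dimension of an intersection of hyperplanes *)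

Lemma dim_cap_lker (K : fieldType) (V : vectType K) (f : 'Hom(V, K^o))
    (U : {vspace V}) (w : V) : w \in U -> f w != 0 ->
  \dim U = (\dim (lker f :&: U)).+1.
Proof.
move=> wU fw; rewrite -(limg_ker_dim f U) capvC -addn1; congr addn.
apply/eqP; rewrite eqn_leq lt0n dimv_eq0; apply/andP; split.
  by rewrite (leq_trans (dimvS (subvf _))) // dimvf.
by apply: contraNneq fw => fU0; rewrite -memv0 -fU0 memv_img.
Qed.

Lemma memv_bigcap (K : fieldType) (V : vectType K) (I : eqType) (s : seq I)
    (U : I -> {vspace V}) (x : V) :
  (x \in \bigcap_(i <- s) U i)%VS = all (fun i => x \in U i) s.
Proof.
by elim: s => [|i s IHs]; rewrite ?big_nil ?memvf // big_cons memv_cap IHs.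
Qed.

(** The vector dual to [f i] lies in all the other kernels but not in its own, so each kernel cuts
    the dimension by exactly one. *)
Lemma dim_bigcap_lker (K : fieldType) (V : vectType K) (I : eqType)
    (f : I -> 'Hom(V, K^o)) (s : seq I) : uniq s ->
  (forall i, i \in s ->
    exists2 w, f i w != 0 & forall j, j \in s -> j != i -> f j w = 0) ->
  (\dim (\bigcap_(i <- s) lker (f i))%VS + size s)%N = \dim {:V}.
Proof.
elim: s => [|i s IHs]; first by rewrite big_nil addn0.
case/andP=> iNs us dual; rewrite -{}IHs //; last first.
  move=> k ks; have [|w fw w0] := dual k; first by rewrite inE ks orbT.
  by exists w => // m ms; apply: w0; rewrite inE ms orbT.
have [|w fw w0] := dual i; first exact: mem_head.
rewrite big_cons /= addnS -addSn -(@dim_cap_lker _ _ _ _ w) //.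
rewrite memv_bigcap; apply/allP => k ks.
rewrite memv_ker w0 ?inE ?ks ?orbT //.
by apply: contraNneq iNs => <-.
Qed.

(** * Addresses, ancestors and gauges *)

Lemma mem_vertices_cons (ts : seq rtree) (i : nat) (a : seq nat) :
  (i :: a \in vertices (Vertex ts)) = (a \in vertices (nth Input ts i)).
Proof.
rewrite inE /=; apply/flatten_mapP/idP => [[m]|ai].
  rewrite mem_iota /= add0n => ltm /mapP [c]; rewrite (nth_map Input) //.
  by move=> cv [-> ->].
have lti : (i < size ts)%N.
  by rewrite ltnNge; apply: contraTN ai => lei; rewrite nth_default.
exists i; first by rewrite mem_iota.
by rewrite (nth_map Input) //; apply/map_f.
Qed.

Lemma vertices_prefix (t : rtree) (a b : seq nat) :
  a ++ b \in vertices t -> a \in vertices t.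
Proof.
elim: a t => [|i a IHa] [|ts] //; rewrite ?mem_head //.
by rewrite cat_cons !mem_vertices_cons => /IHa.
Qed.

Lemma gauge_below (t : rtree) (g : partition3 t) (w v : vert t) :
  is_gauge g -> prefix (addr w) (addr v) -> w != v -> g v <> Above ->
  g w = Below.
Proof.
move=> hg /prefixP [s]; elim/last_ind: s v => [|s i IHs] v.
  by rewrite cats0 => /val_inj ->; rewrite eqxx.
rewrite -rcons_cat => av _ gv.
(* [u] is the parent of [v]; being below the gauge, it satisfies the hypothesis of the induction in
   turn. *)
have uP : addr w ++ s \in vertices t.
  by apply: (@vertices_prefix _ _ [:: i]); rewrite cats1 -av; apply: (valP v).
pose u : vert t := SeqSub uP.
have gu : g u = Below by exact: (hg u v i).
have [->//|wu] := eqVneq w u.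
by apply: (IHs u) => //; rewrite gu.
Qed.

Lemma on_vertices_mem (t : rtree) (g : partition3 t) (v : vert t) :
  (v \in on_vertices g) = is_on (g v).
Proof. by rewrite mem_sort mem_filter mem_enum andbT. Qed.

Lemma on_vertices_uniq (t : rtree) (g : partition3 t) : uniq (on_vertices g).
Proof. by rewrite sort_uniq filter_uniq // enum_uniq. Qed.

(** * The gap [lambda + d(r, v)]: its sign, dual directions and tangent spaces *)

Definition on_side {R : realType} (s : side) (r : R) : Prop :=
  match s with Below => r < 0 | On => r = 0 | Above => 0 < r end.

Section Normals.
Context {R : realType} {t : rtree} {o : #|edge t|.-tuple (edge t)}.
Implicit Types (g : partition3 t) (v : vert t) (x y : 'rV[R]_(#|edge t|.+1)).

Lemma tangentE g :
  tangent R o g = (\bigcap_(v <- on_vertices g) lker (linfun (gap o v)))%VS.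
Proof.
rewrite big_uniq ?on_vertices_uniq //.
by apply: eq_bigl => v; rewrite on_vertices_mem.
Qed.

Lemma mem_tangent g x :
  reflect (forall v, g v = On -> gap o v x = 0) (x \in tangent R o g).
Proof.
rewrite tangentE memv_bigcap; apply: (iffP allP) => [gx v gv|gx v].
  have := gx v; rewrite on_vertices_mem gv memv_ker lfunE => /(_ isT)/eqP //.
by rewrite on_vertices_mem memv_ker lfunE; case E: (g v) => // _; apply/eqP/gx.
Qed.

Lemma gap_line v x y (s : R) :
  gap o v (x + s *: y) = gap o v x + s * gap o v y.
Proof. by rewrite linearD linearZ. Qed.

Lemma gap_normal v x : gap o v x = dot (normal R o v) x.
Proof.
rewrite dotC {1}[x]row_sum_delta linear_sum; apply: eq_bigr => j _.
by rewrite linearZ mxE.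
Qed.

Lemma gap_lambda v : gap o v (delta_mx ord0 ord0 : 'rV[R]_(#|edge t|.+1)) = 1.
Proof.
rewrite /gap /lambda /dist mxE eqxx big1 ?addr0 // => i _.
by rewrite /len mxE.
Qed.

Lemma gap_len v (i : 'I_#|edge t|) :
  gap o v (delta_mx ord0 (lift ord0 i) : 'rV[R]_(#|edge t|.+1)) =
  (on_path (tnth o i) v)%:R.
Proof.
rewrite /gap /lambda /dist mxE andbF add0r big_mkcond (bigD1 i) //=.
rewrite big1 => [|k ki]; last first.
  by rewrite /len mxE (inj_eq lift_inj) (negPf ki) if_same.
by rewrite addr0 /len mxE !eqxx; case: ifP.
Qed.

(* Increasing the length of the edge below [v] (or [lambda], if [v] is the    *)
(* root) moves the gauge with respect to [v] only: no other vertex on the     *)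
(* gauge is above [v].                                                        *)
Lemma gap_dual {g v} : uniq o -> is_gauge g -> g v = On ->
  exists2 w : 'rV[R]_(#|edge t|.+1), gap o v w = 1 &
    forall v', g v' = On -> v' != v -> gap o v' w = 0.
Proof.
move=> uo hg gv.
have noprefix v' : g v' = On -> v' != v -> ~~ prefix (addr v) (addr v').
  move=> gv' v'v; apply/negP => pv.
  have := @gauge_below _ _ v v' hg pv; rewrite eq_sym gv gv' => /(_ v'v) E.
  by discriminate E.
have [av|av] := eqVneq (addr v) [::].
  exists (delta_mx ord0 ord0); first exact: gap_lambda.
  by move=> v' gv' /(noprefix _ gv'); rewrite av prefix0s.
pose e : edge t := Sub v av.
(* A duplicate-free tuple of length [#|edge t|] lists every edge. *)
have eo : e \in o.
  have [|| _ ->] := uniq_min_size uo (s2 := enum (edge t)).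
  - by move=> e' _; rewrite mem_enum.
  - by rewrite -cardE size_tuple.
  - by rewrite mem_enum.
have [i ei] := tnthP _ _ eo.
exists (delta_mx ord0 (lift ord0 i)).
  by rewrite gap_len -ei /on_path SubK prefix_refl.
move=> v' gv' /(noprefix _ gv') /negPf np.
by rewrite gap_len -ei /on_path SubK np.
Qed.

Lemma dim_tangent {g} : uniq o -> is_gauge g ->
  (\dim (tangent R o g) + size (on_vertices g))%N = #|edge t|.+1.
Proof.
move=> uo hg; rewrite tangentE dim_bigcap_lker ?on_vertices_uniq //.
  by rewrite dimvf dim_matrix mul1r.
move=> v; rewrite on_vertices_mem; case gv: (g v) => // _.
have [w gw w0] := gap_dual uo hg gv.
exists w; first by rewrite lfunE /= gw oner_neq0.
move=> k; rewrite on_vertices_mem lfunE /=; case gk: (g k) => // _; exact: w0.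
Qed.

Lemma CT_gapE g x : CT o g x <-> (forall i, 0 < len x i) /\
  forall v, on_side (g v) (gap o v x).
Proof.
rewrite /CT /= /gap; split=> -[lx gx]; split=> // v; move: (gx v);
  case: (g v) => /=.
- by rewrite -ltrBrDl sub0r.
- by move=> <-; rewrite addrN.
- by rewrite -ltrBlDl sub0r.
- by rewrite -ltrBrDl sub0r.
- by move/addr0_eq.
- by rewrite -ltrBlDl sub0r.
Qed.

End Normals.

(** * Small perturbations and comparison of orientations *)

Lemma near0_add_gt0 {R : realType} {a : R} (b : R) : 0 < a ->
  \forall s \near (0 : R)^'+, 0 < a + s * b.
Proof.
move=> a0; have [b0|b0] := leP 0 b.
  apply: filterS (nbhs_right_gt 0) => s s0.
  by apply: ltr_wpDr a0; rewrite mulr_ge0 // ltW.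
have ab : 0 < a / - b by rewrite divr_gt0 ?oppr_gt0.
apply: filterS (nbhs_right_lt ab) => s.
by rewrite ltr_pdivlMr ?oppr_gt0 // mulrN -subr_gt0 opprK.
Qed.

Lemma sgr_mul_gt0 {R : realDomainType} (x y : R) :
  0 < x * y -> Num.sg x = Num.sg y.
Proof.
have [x0|x0|->] := ltgtP x 0; last by rewrite mul0r ltxx.
  by rewrite nmulr_rgt0 // => y0; rewrite !ltr0_sg.
by rewrite pmulr_rgt0 // => y0; rewrite !gtr0_sg.
Qed.

Lemma orient_boundary {R : realType} {t : rtree}
    {o : #|edge t|.-tuple (edge t)} {g g0 : partition3 t} {k : nat}
    {vs : seq (vert t)} {v : vert t} {w u : 'rV[R]_(#|edge t|.+1)}
    {b : seq 'rV[R]_(#|edge t|.+1)} :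
  on_vertices g = vs -> on_vertices g0 = take k vs ++ v :: drop k vs ->
  (k <= size vs)%N -> (size vs + size b)%N = #|edge t| ->
  w \in tangent R o g -> gap o v w = 1 -> <<b>>%VS = tangent R o g0 ->
  u \in tangent R o g -> gap o v u < 0 ->
  orient o g (u :: b) = (-1) ^+ (size vs + k + 1) * orient o g0 b.
Proof.
move=> vsE vs0E lekv szb wg gvw bE ug gvu.
pose nu := [seq normal R o v | v <- vs].
have [d dE] : exists d, forall x, \det (frame (nu ++ x :: b)) = dot d x.
  by apply: det_frame_linear; rewrite size_map -szb ltnS leq_addr.
have sz_frame x : size (nu ++ x :: b) = #|edge t|.+1.
  by rewrite size_cat size_map /= addnS szb.
have dg : d \in tangent R o g.
  apply/mem_tangent => v' gv'; rewrite gap_normal dotC -dE.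
  apply: det_frame_alternate => //; rewrite mem_cat map_f // -vsE.
  by rewrite on_vertices_mem gv'.
have db : {in tangent R o g0, forall x, dot d x = 0}.
  move=> x; rewrite -bE => xb; suff : x \in lker (linfun (dot d)).
    by rewrite memv_ker lfunE => /eqP.
  apply: subvP xb; apply/span_subvP => y yb; rewrite memv_ker lfunE /= -dE.
  by rewrite det_frame_alternate // mem_cat yb orbT.
(* The vector [x - gap o v x *: w] is tangent to the boundary stratum, where [dot d] vanishes. *)
have dw x : x \in tangent R o g -> dot d x = gap o v x * dot d w.
  move=> xg; apply/eqP; rewrite -subr_eq0 -[_ * _]/(_ *: _) -linearZ -linearB.
  apply/eqP/db/mem_tangent => v' g0v'; rewrite linearB linearZ /=.
  have : v' \in on_vertices g0 by rewrite on_vertices_mem g0v'.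
  rewrite vs0E -cat_rcons mem_cat mem_rcons inE -orbA -mem_cat cat_take_drop.
  case/orP=> [/eqP ->|]; first by rewrite gvw [_ *: _]mulr1 subrr.
  rewrite -vsE on_vertices_mem; case gv' : (g v') => // _.
  by rewrite (mem_tangent _ _ xg) // (mem_tangent _ _ wg) // scaler0 subrr.
have sg_normal : Num.sg (dot d (normal R o v)) = Num.sg (dot d w).
  (* If [d = 0], both signs are 0; otherwise the two numbers have product [dot d d > 0]. *)
  have [->|d0] := eqVneq d 0; first by rewrite ![dot 0 _]dotC !linear0.
  by apply: sgr_mul_gt0; rewrite dotC -gap_normal -dw // dot_gt0.
have -> : orient o g (u :: b) = - Num.sg (dot d (normal R o v)).
  rewrite /orient vsE -/(frame _) dE dw // sgrM ltr0_sg // mulN1r.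
  by rewrite sg_normal.
have nuE : nu = take k nu ++ drop k nu by rewrite cat_take_drop.
rewrite -dE nuE -catA det_frame_move; last first.
  by rewrite -size_cat cat_take_drop size_map ltnS -szb leq_addr.
have -> : orient o g0 b =
    Num.sg (\det (frame (take k nu ++ normal R o v :: drop k nu ++ b))).
  by rewrite /orient vs0E map_cat /= map_take map_drop -catA.
(* The exponent is now [j - k + 1]; since [k <= j], it has the parity of [j + k + 1]. *)
rewrite sgrM sgrX sgrN1 -mulNr -[- _ ^+ _]mulN1r -exprS size_drop size_map.
congr (_ * _); rewrite -signr_odd -[RHS]signr_odd addn1 /=.
by rewrite oddB // oddD.
Qed.

Theorem proposition10 (R : realType) (n : nat) (t : rtree)
  (o : #|edge t|.-tuple (edge t)) (g g0 : partition3 t)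
  (j k : nat) (vs : j.-tuple (vert t)) (v : vert t)
  (hn : (2 <= n)%N) (ht : stable t) (htn : arity t = n) (ho : uniq o)
  (hg : is_gauge g) (hg0 : is_gauge g0)
  (hvs : on_vertices g = vs)
  (hbd : gauge_vertex_boundary g g0 v)
  (hk : (k <= j)%N) (hvs0 : on_vertices g0 = take k vs ++ v :: drop k vs)
  (habove : g v = Above) :
  has_boundary_sign R o g g0 ((-1) ^+ (j + k + 1)).
Proof.
have [_ g0v g0E] := hbd.
have sz0 : size (on_vertices g0) = j.+1.
  by rewrite hvs0 size_cat /= addnS -size_cat cat_take_drop size_tuple.
have [w gvw w0] := gap_dual (R := R) ho hg0 g0v.
have g_on v' : g v' = On -> g0 v' = On /\ v' != v.
  have [->|v'v] := eqVneq v' v; first by rewrite habove.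
  by rewrite g0E.
split.
- move=> p /CT_gapE [plen pgap].
  have gpv : gap o v p = 0 by have := pgap v; rewrite g0v.
  split; last by move=> /CT_gapE [_ /(_ v)]; rewrite habove gpv /= ltxx.
  move=> B pB.
  have cvgw : p + s *: w @[s --> (0 : R)^'+] --> p.
    rewrite -{2}[p]addr0 -(scale0r w); apply: cvgD; first exact: cvg_cst.
    by apply: cvgZr_tmp; apply: cvg_at_right_filter; exact: cvg_id.
  have nearB : \forall s \near (0 : R)^'+, B (p + s *: w) := cvgw B pB.
  suff nearCT : \forall s \near (0 : R)^'+, CT o g (p + s *: w).
    by have [s sP] := filter_ex (filterI nearCT nearB); exists (p + s *: w).
  have nearlen : \forall s \near (0 : R)^'+, forall i, 0 < len (p + s *: w) i.
    apply: filter_forall => i; move: (near0_add_gt0 (len w i) (plen i)).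
    by apply: filterS => s; rewrite /len !mxE.
  suff neargap : \forall s \near (0 : R)^'+, forall v',
      on_side (g v') (gap o v' (p + s *: w)).
    by apply: filterS2 nearlen neargap => s *; apply/CT_gapE.
  apply: filter_forall => v'; have [->|v'v] := eqVneq v' v.
    rewrite habove /=; apply: filterS (nbhs_right_gt 0) => s s0.
    by rewrite gap_line gpv gvw add0r mulr1.
  have := pgap v'; rewrite g0E //; case gv' : (g v') => /= gpv'.
  + move: gpv'; rewrite -oppr_gt0 => /(near0_add_gt0 (- gap o v' w)).
    by apply: filterS => s; rewrite gap_line mulrN -opprD oppr_gt0.
  + apply: filterE => s; rewrite gap_line gpv' w0 ?g0E //.
    by rewrite mulr0 addr0.
  + move/(near0_add_gt0 (gap o v' w)): gpv'.
    by apply: filterS => s; rewrite gap_line.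
- apply: (@addIn j); rewrite addSnnS -sz0 -{1}(size_tuple vs) -hvs.
  exact: etrans (dim_tangent ho hg) (esym (dim_tangent ho hg0)).
move=> p u b /CT_gapE [_ pgap] [ug unear] bb.
(* At [p] the gap of [v] is 0, and a small step along [- u] must make it positive. *)
have gu : gap o v u < 0.
  have [s [/= s0]] := filter_ex (filterI (nbhs_right_gt (0 : R)) unear).
  move=> /CT_gapE [_ /(_ v)].
  have := pgap v; rewrite g0v habove /= -scaleNr gap_line => ->.
  by rewrite add0r mulNr oppr_gt0 pmulr_rlt0.
rewrite (@orient_boundary R t o g g0 k vs v w u b) ?size_tuple //.
- have := dim_tangent (R := R) ho hg0.
  rewrite sz0 addnS addnC (size_basis (X := in_tuple b) bb).
  exact: succn_inj.
- by apply/mem_tangent => v' /g_on []; exact: w0.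
- exact: span_basis.
Qed.
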